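(* Let $\boldsymbol\theta_{tr}^*$, $\boldsymbol\theta_r^*$ and $\boldsymbol\theta_f^*$ be, respectively, the parameters trained on $D_{tr}$, the parameters trained on $D_r=D_{tr}\setminus D_f$ (the exact unlearning model), and the parameters unlearned by gradient ascent (GA) on $D_f$. Suppose the second-order (influence-function) approximation holds, i.e. $\boldsymbol\theta_r^*-\boldsymbol\theta_{tr}^*=\Delta\boldsymbol\theta_r$ and $\boldsymbol\theta_f^*-\boldsymbol\theta_{tr}^*=\Delta\boldsymbol\theta_f$, so that $\boldsymbol\theta_r^*-\boldsymbol\theta_f^*=\Delta\boldsymbol\theta_r-\Delta\boldsymbol\theta_f$, with $\Delta\boldsymbol\theta_r,\Delta\boldsymbol\theta_f$ as defined in the context. Then GA achieves exact machine unlearning, i.e. $\boldsymbol\theta_f^*=\boldsymbol\theta_r^*$, if and only if $$\sum_{z^{f}\in D_f}\nabla_{\boldsymbol\theta}\,\ell(h_{\boldsymbol\theta_r^*},z^{f})=\boldsymbol H(\boldsymbol\theta_r^*,\boldsymbol\theta_{tr}^* )\cdot\sum_{z^{f}\in D_f}\nabla_{\boldsymbol\theta}\,\ell(h_{\boldsymbol\theta_{tr}^*},z^{f}),$$ where $$\boldsymbol H(\boldsymbol\theta_r^*,\boldsymbol\theta_{tr}^* )=\Big(\sum_{z^{tr}\in D_{tr}}\nabla^2_{\boldsymbol\theta}\,\ell(h_{\boldsymbol\theta_r^*},z^{tr})\Big)\Big(\sum_{z^{r}\in D_r}\nabla^2_{\boldsymbol\theta}\,\ell(h_{\boldsymbol\theta_{tr}^*},z^{r})\Big)^{-1}.$$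 Otherwise (when this identity fails), GA may fail to help: there exist $\boldsymbol\theta_r^*,\boldsymbol\theta_{tr}^*$ (arising from some choice of $D_{tr}$, $D_f\subset D_{tr}$, model $h_{\boldsymbol\theta}$ and loss $\ell$ for which $\boldsymbol\theta_r^*-\boldsymbol\theta_{tr}^*=\Delta\boldsymbol\theta_r$ and $\boldsymbol\theta_f^*-\boldsymbol\theta_{tr}^*=\Delta\boldsymbol\theta_f$ hold but the identity $\sum_{z^{f}\in D_f}\nabla_{\boldsymbol\theta}\,\ell(h_{\boldsymbol\theta_r^*},z^{f})=\boldsymbol H(\boldsymbol\theta_r^*,\boldsymbol\theta_{tr}^* )\cdot\sum_{z^{f}\in D_f}\nabla_{\boldsymbol\theta}\,\ell(h_{\boldsymbol\theta_{tr}^*},z^{f})$ fails) such that $\|\boldsymbol\theta_r^*-\boldsymbol\theta_f^*\|>\|\boldsymbol\theta_r^*-\boldsymbol\theta_{tr}^*\|$.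
   Context: $D_{tr}$ is a finite training set of labelled examples, $D_f\subset D_{tr}$ is the forgetting set, and $D_r=D_{tr}\setminus D_f$ is the retained set. $h_{\boldsymbol\theta}$ is a model with parameter vector $\boldsymbol\theta\in\mathbb R^d$, and $\ell(h_{\boldsymbol\theta},z)$ is a loss, twice differentiable in $\boldsymbol\theta$. Gradients $\nabla_{\boldsymbol\theta}$ and Hessians $\nabla^2_{\boldsymbol\theta}$ are taken in $\boldsymbol\theta$ and evaluated at the indicated parameter. Empirical risks are sums (not averages). $\boldsymbol\theta_{tr}^*$ minimizes $\sum_{z\in D_{tr}}\ell(h_{\boldsymbol\theta},z)$ and $\boldsymbol\theta_r^*$ minimizes $\sum_{z\in D_r}\ell(h_{\boldsymbol\theta},z)$. In particular, $\sum_{z\in D_{tr}}\nabla_{\boldsymbol\theta}\ell(h_{\boldsymbol\theta_{tr}^*},z)=0$ and $\sum_{z\in D_r}\nabla_{\boldsymbol\theta}\ell(h_{\boldsymbol\theta_r^*},z)=0$. The GA parameter $\boldsymbol\theta_f^*$ is a minimizer of $\sum_{z\in D_{tr}}\ell(h_{\boldsymbol\theta},z)+\varepsilon\sum_{z\in D_f}\ell(h_{\boldsymbol\theta},z)$ with $\varepsilon=-1$, in the Taylor-expansion approximation stated below. Approximation. First-order Taylor expansion of the optimality conditions gives the following displacements, treated as exact: $$\boldsymbol\theta_r^*-\boldsymbol\theta_{tr}^*=\Delta\boldsymbol\theta_r:=\Big(\sum_{z^{tr}\in D_{tr}}\nabla^2_{\boldsymbol\theta}\ell(h_{\boldsymbol\theta_r^*},z^{tr})\Big)^{-1}\sum_{z^{tr}\in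 D_{tr}}\nabla_{\boldsymbol\theta}\ell(h_{\boldsymbol\theta_r^*},z^{tr}),$$ $$\boldsymbol\theta_f^*-\boldsymbol\theta_{tr}^*=\Delta\boldsymbol\theta_f:=\Big(\sum_{z^{r}\in D_r}\nabla^2_{\boldsymbol\theta}\ell(h_{\boldsymbol\theta_{tr}^*},z^{r})\Big)^{-1}\sum_{z^{f}\in D_f}\nabla_{\boldsymbol\theta}\ell(h_{\boldsymbol\theta_{tr}^*},z^{f}).$$ The Hessian sums being inverted are assumed invertible. $\|\cdot\|$ is the Euclidean norm. *)

(* Defs.v *)
From HB Require Import structures.
From mathcomp Require Import all_boot all_order all_algebra finmap.
From mathcomp Require Import all_classical all_reals all_analysis.

Set Implicit Arguments.
Unset Strict Implicit.
Unset Printing Implicit Defensive.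

Import Order.TTheory GRing.Theory Num.Theory.
Import numFieldNormedType.Exports.

Local Open Scope ring_scope.

(* The library norm on matrices is the max norm, which is why the Euclidean
   norm is introduced.  Both norms induce the same topology, so [differentiable]
   and ['D_v] below have their usual meaning on R^d. *)
Definition eucl_norm (R : realType) (d : nat) (v : 'cV[R]_d) : R :=
  Num.sqrt (\sum_(i < d) v i 0 ^+ 2).

Definition partial (R : realType) (d : nat) (i : 'I_d) (f : 'cV[R]_d -> R)
    (t : 'cV[R]_d) : R :=
  'D_(delta_mx i 0) f t.

Definition gradient (R : realType) (d : nat) (f : 'cV[R]_d -> R)
    (t : 'cV[R]_d) : 'cV[R]_d :=
  \col_(i < d) partial i f t.

Definition hessian (R : realType) (d : nat) (f : 'cV[R]_d -> R)
    (t : 'cV[R]_d) : 'M[R]_d :=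
  \matrix_(i < d, j < d) partial j (partial i f) t.

(* Frechet differentiability of [f] and of its gradient, everywhere. *)
Definition twice_differentiable (R : realType) (d : nat)
    (f : 'cV[R]_d -> R) : Prop :=
  (forall t, differentiable f t) /\ (forall t, differentiable (gradient f) t).

Definition is_minimizer (R : realType) (d : nat) (f : 'cV[R]_d -> R)
    (t : 'cV[R]_d) : Prop :=
  forall u, f t <= f u.

(* A labelled example is a pair (input, label) in X * Y; a model assigns to each
   parameter a predictor X -> O; a loss compares a predictor with an example. *)
Definition loss_of (R : realType) (d : nat) (X Y : choiceType) (O : Type)
    (h : 'cV[R]_d -> X -> O) (l : (X -> O) -> X * Y -> R) (z : X * Y)
    (t : 'cV[R]_d) : R :=
  l (h t) z.

Definition risk (R : realType) (d : nat) (X Y : choiceType) (O : Type)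
    (h : 'cV[R]_d -> X -> O) (l : (X -> O) -> X * Y -> R)
    (D : {fset (X * Y)%type}) (t : 'cV[R]_d) : R :=
  \sum_(z <- D) loss_of h l z t.

Definition grad_sum (R : realType) (d : nat) (X Y : choiceType) (O : Type)
    (h : 'cV[R]_d -> X -> O) (l : (X -> O) -> X * Y -> R)
    (D : {fset (X * Y)%type}) (t : 'cV[R]_d) : 'cV[R]_d :=
  \sum_(z <- D) gradient (loss_of h l z) t.

Definition hess_sum (R : realType) (d : nat) (X Y : choiceType) (O : Type)
    (h : 'cV[R]_d -> X -> O) (l : (X -> O) -> X * Y -> R)
    (D : {fset (X * Y)%type}) (t : 'cV[R]_d) : 'M[R]_d :=
  \sum_(z <- D) hessian (loss_of h l z) t.

Definition retained (X Y : choiceType) (Dtr Df : {fset (X * Y)%type}) :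
    {fset (X * Y)%type} :=
  (Dtr `\` Df)%fset.

Definition delta_r (R : realType) (d : nat) (X Y : choiceType) (O : Type)
    (h : 'cV[R]_d -> X -> O) (l : (X -> O) -> X * Y -> R)
    (Dtr : {fset (X * Y)%type}) (t_r : 'cV[R]_d) : 'cV[R]_d :=
  invmx (hess_sum h l Dtr t_r) *m grad_sum h l Dtr t_r.

Definition delta_f (R : realType) (d : nat) (X Y : choiceType) (O : Type)
    (h : 'cV[R]_d -> X -> O) (l : (X -> O) -> X * Y -> R)
    (Dtr Df : {fset (X * Y)%type}) (t_tr : 'cV[R]_d) : 'cV[R]_d :=
  invmx (hess_sum h l (retained Dtr Df) t_tr) *m grad_sum h l Df t_tr.

Definition Hmx (R : realType) (d : nat) (X Y : choiceType) (O : Type)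
    (h : 'cV[R]_d -> X -> O) (l : (X -> O) -> X * Y -> R)
    (Dtr Df : {fset (X * Y)%type}) (t_r t_tr : 'cV[R]_d) : 'M[R]_d :=
  hess_sum h l Dtr t_r *m invmx (hess_sum h l (retained Dtr Df) t_tr).

(* Trained, exactly unlearned and gradient-ascent parameters [t_tr], [t_r],
   [t_f] for which the influence-function displacements are exact.  The
   parameter [t_f] minimizes risk(Dtr) + eps * risk(Df), eps = -1, only in the
   first-order Taylor approximation of the optimality condition, so its
   displacement from [t_tr] is what determines it. *)
Record unlearning_setup (R : realType) (d : nat) (X Y : choiceType) (O : Type)
    (h : 'cV[R]_d -> X -> O) (l : (X -> O) -> X * Y -> R)
    (Dtr Df : {fset (X * Y)%type}) (t_tr t_r t_f : 'cV[R]_d) : Prop :=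
  UnlearningSetup {
    forget_sub : (Df `<=` Dtr)%fset;
    loss_twice_diff : forall z, twice_differentiable (loss_of h l z);
    trained_min : is_minimizer (risk h l Dtr) t_tr;
    retrained_min : is_minimizer (risk h l (retained Dtr Df)) t_r;
    hess_tr_unit : hess_sum h l Dtr t_r \in unitmx;
    hess_r_unit : hess_sum h l (retained Dtr Df) t_tr \in unitmx;
    disp_r_exact : t_r - t_tr = delta_r h l Dtr t_r;
    disp_f_exact : t_f - t_tr = delta_f h l Dtr Df t_tr
  }.

Definition ga_identity (R : realType) (d : nat) (X Y : choiceType) (O : Type)
    (h : 'cV[R]_d -> X -> O) (l : (X -> O) -> X * Y -> R)
    (Dtr Df : {fset (X * Y)%type}) (t_tr t_r : 'cV[R]_d) : Prop :=
  grad_sum h l Df t_r = Hmx h l Dtr Df t_r t_tr *m grad_sum h l Df t_tr.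

(* Main.v *)
Require Import Defs.
From mathcomp Require Import all_boot all_order all_algebra finmap.
From mathcomp Require Import all_classical all_reals all_analysis.
From mathcomp Require Import ring lra.

Import Order.TTheory GRing.Theory Num.Theory.
Import numFieldNormedType.Exports.

Local Open Scope ring_scope.

(* At the minimizer t_r of the retained risk the gradient over Dtr reduces to
   the gradient over Df, so cancelling the inverse Hessians turns
   delta_r = delta_f into the identity.

   For the counterexample, the losses are separable: p.[t_1] + ... + p.[t_d] for
   a polynomial p.  The total risk comes from (X - 1)^2, for which delta_r is
   exact, and the retained risk from the double well (X^2 - 4)^2, which is
   minimal at 2 and concave near 1.  The displacement delta_f is the Newton step
   of the retained risk from t_tr = 1; because of the concavity it moves away
   from 2, to -2, in every coordinate. *)

(** * First-order optimality and gradients of empirical risks *)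

Section FirstOrder.
Context {R : realType} {d : nat}.
Implicit Types (f : 'cV[R]_d -> R) (t v : 'cV[R]_d).

(** Restricting [f] to the line through [t] in direction [v] reduces this to Fermat's theorem in one
    variable, at the interior point 0 of the interval from -1 to 1. *)
Lemma derive_min0 f t v :
  (forall u, differentiable f u) ->
  is_minimizer f t -> 'D_v f t = 0.
Proof.
move=> df fmin.
pose g (s : R) := f (s *: v + t).
have dg s : derivable g s 1.
  by apply/derivable1_diffP; apply: differentiable_comp.
have g0 : is_derive (0 : R) 1 g 0.
  apply: (@derive1_at_min _ g (-1) 1) => //.
  - by rewrite in_itv /= ltrN10 ltr01.
  - by move=> s _; rewrite /g scale0r add0r; exact: fmin.
rewrite -(@derive_val _ _ _ _ _ _ _ g0) /derive /g.
(* The derivatives of [g] at 0 and of [f] along [v] are limits of the same difference quotient, up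
   to simplification. *)
set q := fun s : R => s^-1 *: _; set q' := fun s : R => s^-1 *: _.
suff -> : q = q' by [].
by apply/funext => s; rewrite /q /q' /= addr0 scale0r add0r [_%:A]mulr1.
Qed.

Lemma gradient_min0 f t :
  (forall u, differentiable f u) -> is_minimizer f t -> gradient f t = 0.
Proof. by move=> df fmin; apply/colP => i; rewrite !mxE; exact: derive_min0. Qed.

Context {X Y : choiceType} {O : Type}.
Variables (h : 'cV[R]_d -> X -> O) (l : (X -> O) -> X * Y -> R).
Hypothesis dl : forall z t, differentiable (loss_of h l z) t.
Implicit Types D : {fset (X * Y)%type}.

Lemma riskE D : risk h l D = \sum_(z <- D) loss_of h l z.
Proof. by apply/funext => t; rewrite fct_sumE. Qed.

Lemma differentiable_risk D t : differentiable (risk h l D) t.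
Proof.
rewrite riskE; elim/big_ind: _ => [|f g|z _]; last exact: dl.
- exact: differentiable_cst.
- exact: differentiableD.
Qed.

Lemma gradient_risk D t : gradient (risk h l D) t = grad_sum h l D t.
Proof.
apply/colP => i; rewrite mxE summxE /partial riskE.
under [RHS]eq_bigr do rewrite mxE.
(* [is_derive] carries both derivability and the value of the derivative through the induction on
   the sum. *)
suff s : is_derive t (delta_mx i 0) (\sum_(z <- D) loss_of h l z)
    (\sum_(z <- D) partial i (loss_of h l z) t) by rewrite derive_val.
elim/big_ind2: _ => [|????|z _]; [exact: is_derive_cst|exact: is_deriveD|].
exact/derivableP/diff_derivable.
Qed.

Lemma grad_sum_min0 D t : is_minimizer (risk h l D) t -> grad_sum h l D t = 0.
Proof.
by rewrite -gradient_risk; apply: gradient_min0 => u; exact: differentiable_risk.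
Qed.

Lemma grad_sum_retained D D' t : (D' `<=` D)%fset ->
  grad_sum h l D t = grad_sum h l (retained D D') t + grad_sum h l D' t.
Proof.
move=> sD; rewrite /grad_sum /retained (big_fsetID _ (mem D')) /= addrC.
congr (_ + _); apply: eq_fbigl => z; rewrite !inE //=.
- by rewrite andbC.
- by rewrite andb_idl //; exact: (fsubsetP sD).
Qed.

End FirstOrder.

(** * The equivalence between exact unlearning and the gradient identity *)

Lemma exact_unlearning_iff {R : realType} {d : nat} (X Y : choiceType) (O : Type)
    (h : 'cV[R]_d -> X -> O) (l : (X -> O) -> X * Y -> R)
    (Dtr Df : {fset (X * Y)%type}) (t_tr t_r t_f : 'cV[R]_d) :
  unlearning_setup h l Dtr Df t_tr t_r t_f ->
  (t_f = t_r <-> ga_identity h l Dtr Df t_tr t_r).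
Proof.
case=> sD dl _ rmin uHtr uHr er ef.
have dl1 z t : differentiable (loss_of h l z) t by have [+ _] := dl z; apply.
have eg : grad_sum h l Dtr t_r = grad_sum h l Df t_r.
  by rewrite (grad_sum_retained h l _ _ _ sD) (grad_sum_min0 _ _ dl1 _ _ rmin) add0r.
rewrite /delta_r eg in er; rewrite /delta_f in ef.
(* By [ef], the right side of the identity is the Hessian over [Dtr] at [t_r] applied to
   [t_f - t_tr]. It remains to compare with [er], moving this invertible Hessian across. *)
rewrite /ga_identity /Hmx -mulmxA -ef; split => [->|e].
- by rewrite er (mulKVmx uHtr).
- by move: er; rewrite e (mulKmx uHtr) => /addIr.
Qed.

(** * Calculus of separable polynomial functions *)

Definition coord_sum {R : realType} {d : nat} (p : {poly R}) (t : 'cV[R]_d) : R :=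
  \sum_(i < d) p.[t i 0].

Section CoordSum.
Context {R : realType} {d : nat}.
Implicit Types (p : {poly R}) (t v : 'cV[R]_d).

Lemma differentiable_horner_coord p (i : 'I_d) t :
  differentiable (fun u : 'cV[R]_d => p.[u i 0]) t.
Proof.
apply: (@differentiable_comp _ _ _ _ (fun u : 'cV[R]_d => u i 0) (horner p)).
- exact: differentiable_coord.
- exact/derivable1_diffP/derivable_horner.
Qed.

Lemma derive_horner_coord p (i : 'I_d) t v :
  'D_v (fun u : 'cV[R]_d => p.[u i 0]) t = v i 0 * p^`().[t i 0].
Proof.
pose c (u : 'cV[R]_d) := u i 0.
have dc : differentiable c t by exact: differentiable_coord.
have dp : differentiable (horner p) (t i 0).
  exact/derivable1_diffP/derivable_horner.
(* This is the entry at [i] of the derivative of the identity map along [v]; the chain rule then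
   gives the result. *)
have Dc : 'D_v c t = v i 0.
  have := @derive_id _ _ t v.
  by rewrite derive_mx; [move=> /matrixP/(_ i 0); rewrite mxE|exact: derivable_id].
rewrite deriveE; last exact: differentiable_horner_coord.
rewrite (@diff_comp _ _ _ _ c (horner p)) //= diff1E // -derivE.
by rewrite -Dc deriveE.
Qed.

Lemma coord_sumE p :
  coord_sum p = \sum_(i < d) (fun u : 'cV[R]_d => p.[u i 0]).
Proof. by apply/funext => t; rewrite fct_sumE. Qed.

Lemma differentiable_coord_sum p t : differentiable (coord_sum p) t.
Proof.
rewrite coord_sumE; apply: differentiable_sum => i.
exact: differentiable_horner_coord.
Qed.

Lemma partial_coord_sum p (j : 'I_d) :
  partial j (coord_sum p) = fun t => p^`().[t j 0].
Proof.
apply/funext => t; rewrite /partial coord_sumE derive_sum; last first.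
  by move=> i; apply/diff_derivable/differentiable_horner_coord.
rewrite (bigD1 j) //= big1 => [|i ij].
- by rewrite derive_horner_coord mxE !eqxx mul1r addr0.
- by rewrite derive_horner_coord mxE (negbTE ij) mul0r.
Qed.

Lemma gradient_coord_sum p t :
  gradient (coord_sum p) t = \col_(i < d) p^`().[t i 0].
Proof. by apply/colP => i; rewrite !mxE partial_coord_sum. Qed.

Lemma hessian_coord_sum p t :
  hessian (coord_sum p) t = diag_mx (\row_(i < d) p^`()^`().[t i 0]).
Proof.
apply/matrixP => i j; rewrite !mxE partial_coord_sum {1}/partial.
rewrite derive_horner_coord mxE eqxx andbT.
by rewrite mulr_natl.
Qed.

Lemma twice_differentiable_coord_sum p :
  twice_differentiable (@coord_sum R d p).
Proof.
split=> t; first exact: differentiable_coord_sum.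
(* Expanding the gradient in the standard basis reduces its differentiability to that of scalar
   functions of one coordinate. *)
have -> : gradient (coord_sum p) =
    \sum_(i < d) (fun u : 'cV[R]_d => p^`().[u i 0] *: (delta_mx i 0 : 'cV[R]_d)).
  apply/funext => u; rewrite gradient_coord_sum fct_sumE [LHS]matrix_sum_delta.
  by apply: eq_bigr => i _; rewrite big_ord1 mxE.
apply: differentiable_sum => i; apply: differentiableZl.
exact: differentiable_horner_coord.
Qed.

Lemma coord_sum_min p (c : R) : (forall x, p.[c] <= p.[x]) ->
  is_minimizer (@coord_sum R d p) (const_mx c).
Proof. by move=> pmin u; apply: ler_sum => i _; rewrite mxE. Qed.

(** On constant vectors gradients stay constant and, by the next lemma, Hessians are scalar
    matrices, so the d-dimensional conditions become conditions on one real variable. *)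
Lemma gradient_coord_sum_const p (c : R) :
  gradient (coord_sum p) (const_mx c : 'cV[R]_d) = const_mx p^`().[c].
Proof. by rewrite gradient_coord_sum; apply/colP => i; rewrite !mxE. Qed.

Lemma hessian_coord_sum_const p (c : R) :
  hessian (coord_sum p) (const_mx c : 'cV[R]_d) = p^`()^`().[c]%:M.
Proof.
by rewrite hessian_coord_sum; apply/matrixP => i j; rewrite !mxE.
Qed.

Lemma eucl_norm_const (c : R) :
  eucl_norm (const_mx c : 'cV[R]_d) = Num.sqrt (c ^+ 2 *+ d).
Proof.
rewrite /eucl_norm; under eq_bigr do rewrite mxE.
by rewrite sumr_const card_ord.
Qed.

End CoordSum.

(** * Two-example problems with prescribed total and retained risks *)

Section SeparableUnlearning.
Context {R : realType} {d : nat}.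
Variables (p_tr p_r : {poly R}).

(** The predictor is constant with value the parameter, so a loss can recover the parameter by
    evaluating it at any input and can be any function of it. *)
Let h (t : 'cV[R]_d) (_ : bool) : 'cV[R]_d := t.
(** The forgotten example gets the difference [p_tr - p_r], so that the total risk comes from [p_tr]
    and the retained risk from [p_r], chosen independently. *)
Let l (g : bool -> 'cV[R]_d) (z : bool * unit) : R :=
  coord_sum (if z.1 then p_r else p_tr - p_r) (g true).
Let Dtr : {fset (bool * unit)%type} := [fset (true, tt); (false, tt)]%fset.
Let Df : {fset (bool * unit)%type} := [fset (false, tt)]%fset.

Let sum_Dtr (V : nmodType) (F : bool * unit -> V) :
  \sum_(z <- Dtr) F z = F (true, tt) + F (false, tt).
Proof. by rewrite big_fsetU1 ?inE //= big_seq_fset1. Qed.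

Let retainedE : retained Dtr Df = [fset (true, tt)]%fset.
Proof. by apply/fsetP => -[[] []]; rewrite !inE. Qed.

Let loss_ofE z : loss_of h l z = coord_sum (if z.1 then p_r else p_tr - p_r).
Proof. by []. Qed.

Let risk_tr : risk h l Dtr = coord_sum p_tr.
Proof.
apply/funext => t; rewrite /risk sum_Dtr !loss_ofE /coord_sum -big_split /=.
by apply: eq_bigr => i _; rewrite -hornerD subrKC.
Qed.

Let risk_r : risk h l (retained Dtr Df) = coord_sum p_r.
Proof. by apply/funext => t; rewrite /risk retainedE big_seq_fset1. Qed.

Let grad_tr (c : R) : grad_sum h l Dtr (const_mx c) = const_mx p_tr^`().[c].
Proof.
rewrite /grad_sum sum_Dtr !loss_ofE !gradient_coord_sum_const.
by apply/colP => i; rewrite !mxE -hornerD -derivD subrKC.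
Qed.

Let grad_f (c : R) :
  grad_sum h l Df (const_mx c) = const_mx (p_tr^`().[c] - p_r^`().[c]).
Proof.
rewrite /grad_sum big_seq_fset1 loss_ofE gradient_coord_sum_const.
by rewrite derivB hornerD hornerN.
Qed.

Let hess_tr (c : R) : hess_sum h l Dtr (const_mx c) = p_tr^`()^`().[c]%:M.
Proof.
rewrite /hess_sum sum_Dtr !loss_ofE !hessian_coord_sum_const -raddfD /=.
by rewrite -hornerD -!derivD subrKC.
Qed.

Let hess_r (c : R) :
  hess_sum h l (retained Dtr Df) (const_mx c) = p_r^`()^`().[c]%:M.
Proof.
by rewrite /hess_sum retainedE big_seq_fset1 loss_ofE hessian_coord_sum_const.
Qed.

Let scalar_unit (c : R) : c != 0 -> (c%:M : 'M[R]_d) \in unitmx.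
Proof. by move=> c0; rewrite unitmxE det_scalar unitrX // unitfE. Qed.

Let invmx_mul_const (c x : R) :
  invmx (c%:M : 'M[R]_d) *m (const_mx x : 'cV[R]_d) = const_mx (c^-1 * x).
Proof.
by rewrite invmx_scalar mul_scalar_mx; apply/colP => i; rewrite !mxE.
Qed.

(* delta_f is the Newton step of p_r from a, because p_tr is critical at a. *)
Lemma separable_setup (a b : R) :
    (forall x, p_tr.[a] <= p_tr.[x]) -> (forall x, p_r.[b] <= p_r.[x]) ->
    p_tr^`().[a] = 0 -> p_tr^`()^`().[b] != 0 -> p_r^`()^`().[a] != 0 ->
    b - a = p_tr^`().[b] / p_tr^`()^`().[b] ->
  exists (h : 'cV[R]_d -> bool -> 'cV[R]_d)
      (l : (bool -> 'cV[R]_d) -> bool * unit -> R)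
      (Dtr Df : {fset (bool * unit)%type}),
    unlearning_setup h l Dtr Df (const_mx a) (const_mx b)
      (const_mx (a - p_r^`().[a] / p_r^`()^`().[a])).
Proof.
move=> mina minb crit htr hr exact_r; exists h, l, Dtr, Df; split.
- by apply/fsubsetP => z; rewrite !inE orbC => ->.
- by move=> z; exact: twice_differentiable_coord_sum.
- by rewrite risk_tr; exact: coord_sum_min.
- by rewrite risk_r; exact: coord_sum_min.
- by rewrite hess_tr scalar_unit.
- by rewrite hess_r scalar_unit.
- rewrite /delta_r hess_tr grad_tr invmx_mul_const.
  by apply/colP => i; rewrite !mxE exact_r mulrC.
- rewrite /delta_f hess_r grad_f invmx_mul_const crit.
  by apply/colP => i; rewrite !mxE; ring.
Qed.

End SeparableUnlearning.

(** * The double-well counterexample *)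

Lemma newton_overshoot_setup (R : realType) (d : nat) :
  exists (h : 'cV[R]_d -> bool -> 'cV[R]_d)
      (l : (bool -> 'cV[R]_d) -> bool * unit -> R)
      (Dtr Df : {fset (bool * unit)%type}),
    unlearning_setup h l Dtr Df (const_mx 1) (const_mx 2) (const_mx (- 2)).
Proof.
pose p_tr : {poly R} := ('X - 1%:P) ^+ 2.
pose p_r : {poly R} := ('X^2 - 4%:P) ^+ 2.
have dp_tr x : p_tr^`().[x] = 2 * (x - 1).
  by rewrite /p_tr !poly.derivE !hornerE /=; ring.
have ddp_tr x : p_tr^`()^`().[x] = 2.
  by rewrite /p_tr !poly.derivE !hornerE /=; ring.
have dp_r x : p_r^`().[x] = 4 * x * (x ^+ 2 - 4).
  by rewrite /p_r !poly.derivE !hornerE /=; ring.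
have ddp_r1 : p_r^`()^`().[1] = - 4.
  by rewrite /p_r !poly.derivE !hornerE /=; ring.
(* At 1 the first derivative is -12 and the second is -4, so the Newton step is -3 and ends at the
   bottom of the other well. *)
have -> : - 2 = 1 - p_r^`().[1] / p_r^`()^`().[1] :> R.
  by rewrite dp_r ddp_r1; field.
apply: (separable_setup p_tr p_r); rewrite ?dp_tr ?ddp_tr ?ddp_r1.
- by move=> x; rewrite /p_tr !hornerE subrr expr0n /= sqr_ge0.
- move=> x; rewrite /p_r !hornerE.
  by rewrite (_ : 2 ^+ 2 - 4 = 0 :> R) ?expr0n ?sqr_ge0 //=; ring.
- by rewrite subrr mulr0.
- by rewrite pnatr_eq0.
- by rewrite oppr_eq0 pnatr_eq0.
- by field.
Qed.

Theorem theorem1 (R : realType) (d : nat) :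
  (forall (X Y : choiceType) (O : Type)
      (h : 'cV[R]_d -> X -> O) (l : (X -> O) -> X * Y -> R)
      (Dtr Df : {fset (X * Y)%type}) (t_tr t_r t_f : 'cV[R]_d),
    unlearning_setup h l Dtr Df t_tr t_r t_f ->
    (t_f = t_r <-> ga_identity h l Dtr Df t_tr t_r)) /\
  ((0 < d)%N ->
    exists (X Y : choiceType) (O : Type)
      (h : 'cV[R]_d -> X -> O) (l : (X -> O) -> X * Y -> R)
      (Dtr Df : {fset (X * Y)%type}) (t_tr t_r t_f : 'cV[R]_d),
    [/\ unlearning_setup h l Dtr Df t_tr t_r t_f,
        ~ ga_identity h l Dtr Df t_tr t_r &
        eucl_norm (t_r - t_f) > eucl_norm (t_r - t_tr)]).
Proof.
split=> [*|d_gt0]; first exact: exact_unlearning_iff.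
have [h [l [Dtr [Df setup]]]] := newton_overshoot_setup R d.
exists bool, unit, 'cV[R]_d, h, l, Dtr, Df, (const_mx 1), (const_mx 2).
exists (const_mx (- 2)); split=> //.
(* By the equivalence, the identity would force -2 = 2 in the coordinate of index 0, which exists
   because [d] is positive. *)
- move=> /(proj2 (exact_unlearning_iff _ _ _ _ _ _ _ _ _ _ setup)).
  move=> /colP/(_ (Ordinal d_gt0)); rewrite !mxE; lra.
(* Every coordinate is at distance 4 from the unlearned parameter and 1 from the trained one, so the
   squared norms are 16d and d. *)
- rewrite -!raddfB /= !eucl_norm_const ltr_sqrt.
  + by rewrite ltrMn2r d_gt0; lra.
  + by rewrite pmulrn_lgt0 //; lra.
Qed.
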